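(* Let \[ S(x,p)=\sum_{n\ge1}x^n\sum_{w}p^{\mathrm{sper}(w)}, \] where the inner sum is over all Catalan words $w$ of length $n$ avoiding the pattern $(\geq,\geq)$. Then \[ S(x, p)=\frac{1-p^2x-2p^3x^2-\sqrt{1-2p^2x+(p^4-4p^3)x^2}}{2p^3x^2}. \]
   Context: A Catalan word of length $n\ge 0$ is a sequence $w=w_1\cdots w_n$ of non-negative integers with $w_1=0$ and $0\le w_i\le w_{i-1}+1$ for $i=2,\dots,n$. It avoids the pattern $(\geq,\geq)$ if there is no index $i$ with $w_i\ge w_{i+1}\ge w_{i+2}$. To $w$ is associated the polyomino $P(w)$ with $n$ bottom-aligned columns, the $i$-th column consisting of $w_i+1$ unit cells. $\mathrm{sper}(w)$ is half the perimeter of $P(w)$, the perimeter being the number of cell edges of $P(w)$ not shared with another cell of $P(w)$. *)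

(* Defs.v *)
From HB Require Import structures.
From mathcomp Require Import all_boot all_order all_algebra.
From mathcomp Require Import boolp classical_sets.

Set Implicit Arguments.
Unset Strict Implicit.
Unset Printing Implicit Defensive.

Import GRing.Theory.

Definition catalan_word (w : seq nat) : bool :=
  if w is a :: s then (a == 0) && path (fun u v => v <= u.+1) a s else true.

Definition avoids_geq_geq (w : seq nat) : bool :=
  ~~ [exists i : 'I_(size w - 2),
        (nth 0 w i >= nth 0 w i.+1) && (nth 0 w i.+1 >= nth 0 w i.+2)].

(* The pair (i, j) stands for the unit square [i, i + 1] x [j, j + 1]. *)
Definition cells (w : seq nat) : seq (nat * nat) :=
  [seq (i, j) | i <- iota 0 (size w), j <- iota 0 (nth 0 w i).+1].

(* (true, (x, y)) is the segment from (x, y) to (x + 1, y),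
   (false, (x, y)) is the segment from (x, y) to (x, y + 1). *)
Definition cell_edges (c : nat * nat) : seq (bool * (nat * nat)) :=
  let: (i, j) := c in
  [:: (true, (i, j)); (true, (i, j.+1)); (false, (i, j)); (false, (i.+1, j))].

Definition perimeter (w : seq nat) : nat :=
  size [seq e <- undup (flatten (map cell_edges (cells w)))
         | count (fun c => e \in cell_edges c) (cells w) == 1].

(* For bottom-aligned columns the perimeter is always even (every line through
   the centres of a row or a column of squares crosses it an even number of
   times), so no rounding takes place. *)
Definition sper (w : seq nat) : nat := (perimeter w)./2.

(* The letters of a Catalan word of length n are smaller than n, so that the
   Catalan words of length n can be enumerated as tuples over 'I_n. *)
Lemma catalan_word_bound (w : seq nat) :
  catalan_word w -> {in w, forall a, a < size w}.
Proof.
case: w => [|a s] //= /andP[/eqP-> {a}].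
have H : forall (s : seq nat) a, path (fun u v => v <= u.+1) a s ->
  {in a :: s, forall b, b < a + (size s).+1}.
  elim=> [|c t IH] a /=.
    by move=> _ b; rewrite inE => /eqP->; rewrite addn1.
  move=> /andP[ca pt] b; rewrite inE => /orP[/eqP->|bt].
    by rewrite -addSnnS leq_addr.
  by apply: leq_trans (IH _ pt _ bt) _; rewrite -(addSnnS a) leq_add2r.
by move=> /H{}H b /H; rewrite add0n.
Qed.

Local Open Scope ring_scope.

Record fps (R : Type) := Fps { fps_coef : nat -> R }.

Notation "a ``_ n" := (fps_coef a n)
  (at level 3, n at level 2, left associativity, format "a ``_ n") : ring_scope.

Lemma fpsP (R : Type) (a b : fps R) : (forall n, a``_n = b``_n) <-> a = b.
Proof.
split=> [|-> //]; case: a b => [f] [g] /= fg; congr Fps.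
exact/funext.
Qed.

HB.instance Definition _ (R : Type) := gen_eqMixin (fps R).
HB.instance Definition _ (R : Type) := gen_choiceMixin (fps R).

Section FpsZmod.
Variable R : zmodType.
Definition fps_zero : fps R := Fps (fun=> 0).
Definition fps_opp (a : fps R) := Fps (fun n => - a``_n).
Definition fps_add (a b : fps R) := Fps (fun n => a``_n + b``_n).
Fact fps_addA : associative fps_add.
Proof. by move=> a b c; apply/fpsP => n /=; rewrite addrA. Qed.
Fact fps_addC : commutative fps_add.
Proof. by move=> a b; apply/fpsP => n /=; rewrite addrC. Qed.
Fact fps_add0 : left_id fps_zero fps_add.
Proof. by move=> a; apply/fpsP => n /=; rewrite add0r. Qed.
Fact fps_addN : left_inverse fps_zero fps_opp fps_add.
Proof. by move=> a; apply/fpsP => n /=; rewrite addNr. Qed.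
HB.instance Definition _ :=
  GRing.isZmodule.Build (fps R) fps_addA fps_addC fps_add0 fps_addN.
Lemma fps_coef0 n : (0 : fps R)``_n = 0. Proof. by []. Qed.
Lemma fps_coefN (a : fps R) n : (- a)``_n = - a``_n. Proof. by []. Qed.
Lemma fps_coefD (a b : fps R) n : (a + b)``_n = a``_n + b``_n.
Proof. by []. Qed.
Lemma fps_coefB (a b : fps R) n : (a - b)``_n = a``_n - b``_n.
Proof. by []. Qed.
End FpsZmod.

Section FpsRing.
Variable R : comNzRingType.
Implicit Types a b c : fps R.

Definition fpsC (r : R) : fps R := Fps (fun n => if n == 0%N then r else 0).
Definition fpsX : fps R := Fps (fun n => (n == 1%N)%:R).
Definition fps_mul a b := Fps (fun n => \sum_(i < n.+1) a``_i * b``_(n - i)).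

Let T N a : {poly R} := \poly_(i < N.+1) a``_i.
Let coefT N a i : (i <= N)%N -> (T N a)`_i = a``_i.
Proof. by move=> iN; rewrite coef_poly ltnS iN. Qed.
Let mulT N a b i : (i <= N)%N -> (fps_mul a b)``_i = (T N a * T N b)`_i.
Proof.
move=> iN; rewrite coefM /=; apply: eq_bigr => j _; rewrite !coefT //.
  exact: leq_trans (leq_subr _ _) iN.
by apply: leq_trans iN; rewrite -ltnS.
Qed.
Let coefM_eq (N : nat) (p p' q : {poly R}) :
  (forall i, (i <= N)%N -> p`_i = p'`_i) -> (p * q)`_N = (p' * q)`_N.
Proof.
by move=> e; rewrite !coefM; apply: eq_bigr => j _; rewrite e // -ltnS.
Qed.

Fact fps_mulC : commutative fps_mul.
Proof. by move=> a b; apply/fpsP => n; rewrite !(@mulT n) // mulrC. Qed.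
Fact fps_mulA : associative fps_mul.
Proof.
move=> a b c; apply/fpsP => n; rewrite fps_mulC !(@mulT n) //.
rewrite (@coefM_eq n _ (T n b * T n c)); last first.
  by move=> i ni; rewrite coefT // (@mulT n).
rewrite (@coefM_eq n (T n (fps_mul a b)) (T n a * T n b)); last first.
  by move=> i ni; rewrite coefT // (@mulT n).
by rewrite mulrC mulrA.
Qed.
Fact fps_mul1 : left_id (fpsC 1) fps_mul.
Proof.
move=> a; apply/fpsP => n /=; rewrite big_ord_recl /= mul1r subn0 big1 ?addr0//.
by move=> i _; rewrite mul0r.
Qed.
Fact fps_mulDl : left_distributive fps_mul (@fps_add R).
Proof.
move=> a b c; apply/fpsP => n /=; rewrite -big_split.
by apply: eq_bigr => i _; rewrite mulrDl.
Qed.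
Fact fps_1neq0 : fpsC 1 != 0.
Proof.
by apply/eqP => /(congr1 (fun a => a``_0)) /= /eqP; rewrite oner_eq0.
Qed.
HB.instance Definition _ := GRing.Zmodule_isComNzRing.Build (fps R)
  fps_mulA fps_mulC fps_mul1 fps_mulDl fps_1neq0.

Lemma fps_coefM a b n : (a * b)``_n = \sum_(i < n.+1) a``_i * b``_(n - i).
Proof. by []. Qed.
Lemma fps_coefC r n : (fpsC r)``_n = if n == 0%N then r else 0.
Proof. by []. Qed.
Lemma fps_coefX n : fpsX``_n = (n == 1%N)%:R. Proof. by []. Qed.
Lemma fps_coef1 n : (1 : fps R)``_n = (n == 0%N)%:R.
Proof. by rewrite [LHS]/=; case: n. Qed.

(* Units and inverses are only needed to reach the integral domain structure
   (hence fractions of power series). *)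
Definition fps_unit : {pred fps R} := fun a => `[< exists b, b * a = 1 >].
Definition fps_inv a : fps R := xget a [set b | b * a = 1]%classic.
Fact fps_mulVx : {in fps_unit, left_inverse 1 fps_inv *%R}.
Proof.
by move=> a /asboolP h; exact: (@xgetPex _ a [set b | b * a = 1]%classic h).
Qed.
Fact fps_unitPl a b : b * a = 1 -> fps_unit a.
Proof. by move=> ba; apply/asboolP; exists b. Qed.
Fact fps_invr_out : {in [predC fps_unit], fps_inv =1 id}.
Proof.
move=> a /negP na; rewrite /fps_inv.
by case: xgetP => // b _ ba; case: na; exact: fps_unitPl ba.
Qed.
HB.instance Definition _ := GRing.ComNzRing_hasMulInverse.Build (fps R)
  fps_mulVx fps_unitPl fps_invr_out.

End FpsRing.

Arguments fpsX {R}.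

Section FpsIdomain.
Variable R : idomainType.

Fact fps_integral (a b : fps R) : a * b = 0 -> (a == 0) || (b == 0).
Proof.
move=> ab0; case: (eqVneq a 0) => //= a0; apply/negP => /negP b0.
have nz (c : fps R) : c != 0 -> exists n, c``_n != 0.
  move=> c0; apply/not_existsP => h; case/eqP: c0; apply/fpsP => n.
  by apply/eqP/negPn/negP; exact: h.
case: (ex_minnP (nz _ a0)) => m am mmin; case: (ex_minnP (nz _ b0)) => n bn nmin.
have mn : (m < (m + n).+1)%N by rewrite ltnS leq_addr.
have /eqP : (a * b)``_(m + n) = 0 by rewrite ab0.
rewrite fps_coefM (bigD1 (Ordinal mn)) //= addKn big1 ?addr0.
  by rewrite mulf_eq0 (negbTE am) (negbTE bn).
move=> i; rewrite -val_eqE /= neq_ltn => /orP[im|mi].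
  case: (eqVneq a``_i 0) => [->|/mmin]; first by rewrite mul0r.
  by rewrite leqNgt im.
case: (eqVneq b``_(m + n - i) 0) => [->|/nmin]; first by rewrite mulr0.
have im : (i <= m + n)%N by rewrite -ltnS.
by rewrite leq_subRL // leq_add2r leqNgt mi.
Qed.
HB.instance Definition _ :=
  GRing.ComUnitRing_isIntegral.Build (fps R) fps_integral.

(* The square root with constant term 1, see fps_sqrtP and fps_sqrt_uniq. *)
Definition fps_sqrt (a : fps R) : fps R :=
  xget 0 [set r : fps R | r``_0 = 1 /\ r ^+ 2 = a]%classic.

Let half : R := 2%:R^-1.
Fixpoint fps_sqrt_coefs (a : fps R) (n : nat) : seq R :=
  if n is m.+1 then
    let s := fps_sqrt_coefs a m in
    rcons s (half * (a``_n - \sum_(i < m) s`_i.+1 * s`_(m - i)))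
  else [:: 1].

Lemma fps_sqrtP (a : fps R) : (2%:R : R) \is a GRing.unit -> a``_0 = 1 ->
  (fps_sqrt a)``_0 = 1 /\ (fps_sqrt a) ^+ 2 = a.
Proof.
move=> u2 a0; pose r := Fps (fun n => (fps_sqrt_coefs a n)`_n).
suff r_ok : r``_0 = 1 /\ r ^+ 2 = a.
  exact: (@xgetPex _ 0 [set s : fps R | s``_0 = 1 /\ s ^+ 2 = a]%classic
    (ex_intro _ r r_ok)).
have sz n : size (fps_sqrt_coefs a n) = n.+1.
  by elim: n => //= n IH; rewrite size_rcons IH.
have stab n i : (i <= n)%N -> (fps_sqrt_coefs a n)`_i = r``_i.
  elim: n => [|n IH]; first by rewrite leqn0 => /eqP->.
  rewrite leq_eqVlt => /orP[/eqP-> //|]; rewrite ltnS => lin.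
  by rewrite /= nth_rcons sz ltnS lin IH.
split=> //; apply/fpsP => -[|m]; rewrite expr2 fps_coefM.
  by rewrite big_ord_recl big_ord0 addr0 /= mul1r a0.
rewrite big_ord_recl big_ord_recr /= subn0 subnn mul1r mulr1.
rewrite nth_rcons sz ltnn eqxx.
rewrite [X in _ + (X + _)](_ : _ = \sum_(i < m)
  (fps_sqrt_coefs a m)`_i.+1 * (fps_sqrt_coefs a m)`_(m - i)); last first.
  apply: eq_bigr => i _; rewrite /bump /= add1n subSS.
  by rewrite !stab //= leq_subr.
rewrite addrCA -mulr2n -mulrnAl.
have -> : half *+ 2 = 1 by rewrite -mulr_natl mulrV.
by rewrite mul1r addrC subrK.
Qed.

Lemma fps_sqrt_uniq (a r : fps R) : (2%:R : R) != 0 ->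
  r``_0 = 1 -> r ^+ 2 = a -> fps_sqrt a = r.
Proof.
move=> n2 r0 ra; rewrite /fps_sqrt.
case: xgetP => [s _ [s0 sa]|/(_ r)]; last by case.
have /eqP := sa; rewrite -ra eqf_sqr => /orP[/eqP//|/eqP sr].
have /eqP := s0; rewrite sr fps_coefN r0 eq_sym -subr_eq0 opprK -mulr2n.
by rewrite (negbTE n2).
Qed.

End FpsIdomain.

Notation "x %:F" := (@FracField.tofrac _ x) : ring_scope.

(* The variable x is the one of the power series and p is 'X : {poly rat}. *)
Definition S_series : fps {poly rat} :=
  Fps (fun n =>
    if n == 0%N then 0 else
    \sum_(w : n.-tuple 'I_n |
            catalan_word (map val w) && avoids_geq_geq (map val w))
       'X^(sper (map val w))).

(* Main.v *)
(* Bottom-aligned columns have semiperimeter (width) + (sum of the rises), and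
   in a Catalan word every rise except the initial one comes from an ascent by
   exactly 1, so a word of length n with k ascents has weight p^(n + 1 + k).

   With a = p^2 x and b = p^3 x^2, reading words from left to right and
   remembering the last letter h gives series K_h, where K_0 = 1 + S and
     K_h = 1 + a K_(h+1) + b (K_1 + ... + K_(h+1)).
   The defects L_h = K_0 K_h - (1 + a K_0) K_(h+1) of K being geometric satisfy
     L_h = a (L_(h+1) - L_0) + b (L_1 + ... + L_(h+1)),
   whose only solution is 0 because x divides a and b. Then L_0 = 0, together
   with the equation for K_0, gives K_0 = 1 + a K_0 + b K_0^2. *)
Require Import Defs.
From HB Require Import structures.
From mathcomp Require Import all_boot all_order all_algebra.
From mathcomp Require Import ring zify.

Set Implicit Arguments.
Unset Strict Implicit.
Unset Printing Implicit Defensive.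

Import GRing.Theory.
Local Open Scope ring_scope.

(** * The perimeter of a bottom-aligned polyomino in terms of its column heights *)

Section Perimeter.
Local Open Scope nat_scope.
Implicit Types w s : seq nat.

(* The height of column [i - 1], so that both ends are padded by zeros. *)
Definition height w i := nth 0 (0 :: map S w) i.

Lemma mem_cells w i j : ((i, j) \in cells w) = (j < height w i.+1).
Proof.
rewrite /height /=; apply/allpairsPdep/idP => [[x [y [+ + [-> ->]]]]|ltj].
  by rewrite !mem_iota !add0n /= => xw; rewrite (nth_map 0).
have iw : i < size w.
  by case: (ltnP i (size w)) ltj => // wi; rewrite nth_default ?size_map.
exists i, j; rewrite !mem_iota !add0n /=; split=> //.
by rewrite (nth_map 0) in ltj.
Qed.

Lemma uniq_cells w : uniq (cells w).
Proof.
apply: allpairs_uniq_dep => [|i _|[i j] [k l] _ _ /= [-> ->]] //;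
  exact: iota_uniq.
Qed.

(** This segment is the bottom of cell [(i, y)] and, for [0 < y], the top of cell [(i, y.-1)]; no
    other cell touches it. *)
Lemma count_cells_hedge w i y :
  count (fun c => (true, (i, y)) \in cell_edges c) (cells w) =
  (y < height w i.+1) + ((0 < y) && (y.-1 < height w i.+1)).
Proof.
rewrite -[y < _]mem_cells -(count_uniq_mem _ (uniq_cells w)).
case: y => [|y] /=.
  rewrite addn0; apply: eq_count => -[k l].
  by rewrite !inE /= !xpair_eqE /=; lia.
rewrite -mem_cells -(count_uniq_mem _ (uniq_cells w)) -count_predUI.
rewrite [X in _ + X](_ : _ = 0) ?addn0; last first.
  apply/eqP; rewrite -leqn0 leqNgt -has_count; apply/hasPn => -[k l] _ /=.
  by rewrite !xpair_eqE; lia.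
by apply: eq_count => -[k l]; rewrite !inE /= !xpair_eqE /=; lia.
Qed.

Lemma count_cells_vedge w i y :
  count (fun c => (false, (i, y)) \in cell_edges c) (cells w) =
  (y < height w i) + (y < height w i.+1).
Proof.
rewrite -[y < height w i.+1]mem_cells -(count_uniq_mem _ (uniq_cells w)).
case: i => [|i] /=.
  by apply: eq_count => -[k l]; rewrite !inE /= !xpair_eqE /=; lia.
rewrite -mem_cells -(count_uniq_mem _ (uniq_cells w)) -count_predUI.
rewrite [X in _ + X](_ : _ = 0) ?addn0; last first.
  apply/eqP; rewrite -leqn0 leqNgt -has_count; apply/hasPn => -[k l] _ /=.
  by rewrite !xpair_eqE; lia.
by apply: eq_count => -[k l]; rewrite !inE /= !xpair_eqE /=; lia.
Qed.

(** Each column exposes its bottom and its top; between neighbouring columns the exposed vertical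
    segments lie between the smaller and the larger height. *)
Definition boundary_edges w : seq (bool * (nat * nat)) :=
  [seq (true, (i, y)) | i <- iota 0 (size w), y <- [:: 0; height w i.+1]] ++
  [seq (false, (i, y)) | i <- iota 0 (size w).+1,
     y <- iota (minn (height w i) (height w i.+1))
               `|height w i - height w i.+1|].

Lemma height_gt0 w i : (0 < height w i.+1) = (i < size w).
Proof.
rewrite /height /=; case: (ltnP i) => iw; first by rewrite (nth_map 0).
by rewrite nth_default ?size_map.
Qed.

Lemma uniq_boundary_edges w : uniq (boundary_edges w).
Proof.
rewrite /boundary_edges cat_uniq; apply/and3P; split.
- apply: allpairs_uniq_dep => [|i|[i j] [k l] _ _ /= [-> ->]] //.
    exact: iota_uniq.
  rewrite mem_iota add0n /= -height_gt0 inE andbT => h0.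
  by rewrite eq_sym -lt0n.
- apply/hasPn => e /allpairsPdep[i [y [_ _ ->]]].
  by apply/negP => /allpairsPdep[? [? []]].
- by apply: allpairs_uniq_dep => [|i _|[i j] [k l] _ _ /= [-> ->]] //;
    exact: iota_uniq.
Qed.

Lemma mem_boundary_edges w e :
  (e \in boundary_edges w) =
  (count (fun c => e \in cell_edges c) (cells w) == 1).
Proof.
case: e => -[] [i y]; rewrite mem_cat.
  rewrite count_cells_hedge orbC orb_idl; last by case/allpairsPdep => ? [? []].
  apply/allpairsPdep/idP => [[k [z [+ + [-> ->]]]]|].
    rewrite mem_iota add0n /= -height_gt0 !inE; lia.
  move=> H; exists i, y; rewrite mem_iota add0n /= -height_gt0 !inE.
  by split=> //; lia.
rewrite count_cells_vedge orb_idl; last by case/allpairsPdep => ? [? []].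
apply/allpairsPdep/idP => [[k [z [+ + [-> ->]]]]|].
  by rewrite !mem_iota; lia.
move=> H; exists i, y; rewrite !mem_iota add0n /=; split=> //; last by lia.
(* Past the right end both neighbouring heights vanish, so no cell has such an edge. *)
rewrite ltnS; case: leqP => // wi; case: i wi H => // i.
have := height_gt0 w i; have := height_gt0 w i.+1; lia.
Qed.

Lemma perimeterE w : perimeter w =
  (size w).*2 + \sum_(0 <= i < (size w).+1) `|height w i - height w i.+1|.
Proof.
have -> : perimeter w = size (boundary_edges w).
  apply/perm_size/uniq_perm;
    rewrite ?filter_uniq ?undup_uniq ?uniq_boundary_edges //.
  move=> e; rewrite mem_filter mem_undup -mem_boundary_edges.
  case: (boolP (e \in boundary_edges w)) => //=.
  rewrite mem_boundary_edges => /eqP ce.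
  have /hasP[c cw ec] : has (fun c => e \in cell_edges c) (cells w).
    by rewrite has_count ce.
  by apply/flattenP; exists (cell_edges c) => //; apply: map_f.
rewrite size_cat !size_allpairs_dep; congr (_ + _).
  rewrite sumnE big_map (eq_bigr (fun=> 2)) // big_const_seq.
  by rewrite count_predT size_iota iter_addn_0 mul2n.
rewrite sumnE big_map /index_iota subn0.
by apply: eq_bigr => i _; rewrite size_iota.
Qed.

Fixpoint ascents h s : nat :=
  if s is v :: s' then (h < v) + ascents v s' else 0.

(** All rises are by 1, so they total [ascents h s]; the falls exceed them by [h.+1], since the
    heights go from [h.+1] down to the default 0 read past the last column. *)
Lemma sum_height_diff h s : path (fun u v => v <= u.+1) h s ->
  \sum_(0 <= i < (size s).+1)
     `|nth 0 (h.+1 :: map S s) i - nth 0 (h.+1 :: map S s) i.+1| =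
  h.+1 + (ascents h s).*2.
Proof.
elim: s h => [|v s IH] h /=; first by rewrite big_nat1 /=; lia.
case/andP=> vh /IH E; rewrite big_nat_recl // [X in _ + X]E /=; lia.
Qed.

Lemma sper_catalan s : catalan_word (0 :: s) ->
  sper (0 :: s) = size s + ascents 0 s + 2.
Proof.
move=> /= ps; rewrite /sper perimeterE /= big_nat_recl //.
by rewrite (sum_height_diff ps) /height /=; lia.
Qed.

End Perimeter.

(** * Coefficient rules and a uniqueness principle for power series *)

Section FpsLemmas.
Variable R : comNzRingType.
Implicit Types a b : fps R.

Lemma fps_coefXM0 a : (fpsX * a)``_0 = 0.
Proof. by rewrite fps_coefM big_ord1 fps_coefX mul0r. Qed.

Lemma fps_coefXMS a n : (fpsX * a)``_(n.+1) = a``_n.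
Proof.
rewrite fps_coefM big_ord_recl fps_coefX mul0r add0r big_ord_recl /=.
rewrite mul1r subSS subn0 big1 ?addr0 // => i _.
by rewrite /bump /= mul0r.
Qed.

Lemma fps_coefCM (r : R) a n : (fpsC r * a)``_n = r * a``_n.
Proof.
rewrite fps_coefM big_ord_recl /= subn0 big1 ?addr0 // => i _.
by rewrite mul0r.
Qed.

Lemma fps_coef_sum (I : Type) (r : seq I) (P : pred I) (F : I -> fps R) n :
  (\sum_(i <- r | P i) F i)``_n = \sum_(i <- r | P i) (F i)``_n.
Proof. exact: (big_morph (fun a => a``_n)). Qed.

Lemma fpsC_exp (r : R) n : fpsC r ^+ n = fpsC (r ^+ n).
Proof.
elim: n => [|n IH]; first by [].
rewrite !exprS IH; apply/fpsP => k; rewrite fps_coefCM !fps_coefC.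
by case: eqP; rewrite ?mulr0.
Qed.

(** The factor [fpsX] makes each coefficient of [L h] depend only on lower coefficients of the whole
    family, so strong induction on the degree, uniform in [h], applies. *)
Lemma fps_contraction (L : nat -> fps R) (a b : fps R) :
  (forall h,
     L h = fpsX * (a * (L h.+1 - L 0%N) + b * \sum_(j < h.+1) L j.+1)) ->
  forall h, L h = 0.
Proof.
move=> rec h; apply/fpsP => n; rewrite fps_coef0.
have coefM0 c d m :
    (forall i, (i <= m)%N -> d``_i = 0) -> (c * d)``_m = 0.
  move=> d0; rewrite fps_coefM big1 // => i _.
  by rewrite d0 ?mulr0 ?leq_subr.
elim/ltn_ind: n h => -[_|n IH] h; rewrite rec ?fps_coefXM0 // fps_coefXMS.
rewrite fps_coefD !coefM0 ?addr0 // => i; rewrite -ltnS => ilt.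
  by rewrite fps_coef_sum big1 // => j _; exact: IH.
by rewrite fps_coefB !IH // subr0.
Qed.

End FpsLemmas.

(** * Elimination of the last letter [h] from the system *)

Lemma geometric_defect (R : comNzRingType) (a b : R) (K : nat -> R) :
  (forall h, K h = 1 + a * K h.+1 + b * \sum_(j < h.+1) K j.+1) ->
  let L h := K 0%N * K h - (1 + a * K 0%N) * K h.+1 in
  forall h, L h = a * (L h.+1 - L 0%N) + b * \sum_(j < h.+1) L j.+1.
Proof.
move=> KE L h; rewrite /L sumrB -!mulr_sumr.
have := KE 0%N; rewrite big_ord1.
have := KE h.+1; rewrite big_ord_recl /=.
have := KE h.
set A := \sum_(j < _) K j.+1; set B := \sum_(j < h.+1) K _.
move=> /eqP; rewrite -subr_eq0 => /eqP E1.
move=> /eqP; rewrite -subr_eq0 => /eqP E2.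
move=> /eqP; rewrite -subr_eq0 => /eqP E3.
apply: subr0_eq.
(* The equations at [h] and [h.+1] are weighted as in [L h]; the one at 0 absorbs the constants,
   [L 0] and the term [b * K 1] missing from the shifted sum. *)
transitivity (K 0%N * (K h - (1 + a * K h.+1 + b * A))
  - (1 + a * K 0%N) * (K h.+1 - (1 + a * K h.+2 + b * (K 1%N + B)))
  + (1 + a * K 0%N) * (K 0%N - (1 + a * K 1%N + b * K 1%N))); first by ring.
by rewrite E1 E2 E3 !mulr0 subrr addr0.
Qed.

Lemma catalytic_quadratic (R : comNzRingType) (a b : fps R) (K : nat -> fps R) :
  (forall h, K h = 1 + fpsX * a * K h.+1
                     + fpsX * b * \sum_(j < h.+1) K j.+1) ->
  K 0%N = 1 + fpsX * a * K 0%N + fpsX * b * K 0%N ^+ 2.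
Proof.
move=> KE; have := geometric_defect KE; set L := fun h => _ => /= LE.
have L0 : L 0%N = 0.
  apply: (@fps_contraction _ L a b) => h.
  by rewrite mulrDr !mulrA; exact: LE.
have := KE 0%N; rewrite big_ord1 => /eqP; rewrite -subr_eq0 => /eqP E.
apply: subr0_eq.
(* The equation at 0 is multiplied by the coefficient of [K 1] in [L 0]; then [L 0 = 0] trades [K 1]
   for [K 0 ^+ 2]. *)
transitivity ((1 + fpsX * a * K 0%N)
                * (K 0%N - (1 + fpsX * a * K 1%N + fpsX * b * K 1%N))
              - (fpsX * a + fpsX * b) * L 0%N).
  by rewrite /L; ring.
by rewrite E L0 !mulr0 subrr.
Qed.

(** * Avoiding Catalan words, read letter by letter *)

Section Words.
Local Open Scope nat_scope.
Implicit Types s : seq nat.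

(* [extension b h s]: the letters [s] may follow a letter [h] in an avoiding
   Catalan word, where [b] records whether [h] ends a weak descent. *)
Fixpoint extension b h s : bool :=
  if s is v :: s' then
    if v <= h then ~~ b && extension true v s'
    else (v == h.+1) && extension false v s'
  else true.

Lemma avoids_cons2 h v s :
  avoids_geq_geq (h :: v :: s) =
  ~~ ((v <= h) && (if s is u :: _ then u <= v else false))
  && avoids_geq_geq (v :: s).
Proof.
rewrite /avoids_geq_geq -negb_or; congr (~~ _).
case: s => [|u s].
  by rewrite andbF; apply/existsP/existsP => -[[i]].
apply/existsP/orP => [[[[|i] /= li] H]|[H|/existsP[[i /= li] H]]].
- by left.
- have li' : i < size [:: v, u & s] - 2 by move: li => /=; lia.
  by right; apply/existsP; exists (Ordinal li').
- have lt0 : 0 < size [:: h, v, u & s] - 2 by rewrite /=; lia.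
  by exists (Ordinal lt0).
- have li' : i.+1 < size [:: h, v, u & s] - 2 by move: li => /=; lia.
  by exists (Ordinal li').
Qed.

(** Avoidance forbids two consecutive weak descents, so one bit of memory suffices; and
    [h < v <= h.+1] leaves only [v = h.+1]. *)
Lemma extensionE b h s :
  extension b h s =
  [&& path (fun u v => v <= u.+1) h s, avoids_geq_geq (h :: s)
    & ~~ (b && (if s is v :: _ then v <= h else false))].
Proof.
elim: s b h => [|v s IH] b h.
  rewrite /= andbF andbT /avoids_geq_geq; apply/esym/existsPn => -[i +] //.
rewrite avoids_cons2 /=; case: (leqP v h) => vh.
  rewrite IH; case: b; case: s {IH} => [|u s];
    by rewrite /= ?andbF ?andbT //; lia.
rewrite IH /= ?andbF ?andbT; case: (eqVneq v h.+1) => [->|nvh].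
  by rewrite leqnn.
by rewrite leq_eqVlt (negbTE nvh) ltnS leqNgt vh.
Qed.

(** Listing by first letter turns sums over words directly into recurrences; after a weak descent
    only [h.+1] can follow. *)
Fixpoint extensions n b h : seq (seq nat) :=
  if n is n'.+1 then
    map (cons h.+1) (extensions n' false h.+1) ++
    if b then [::]
    else [seq v :: s | v <- iota 0 h.+1, s <- extensions n' true v]
  else [:: [::]].

Lemma extensions_true n h :
  extensions n.+1 true h = map (cons h.+1) (extensions n false h.+1).
Proof. exact: cats0. Qed.

Lemma extensions_false n h :
  extensions n.+1 false h = extensions n.+1 true h ++
    [seq v :: s | v <- iota 0 h.+1, s <- extensions n true v].
Proof. by rewrite extensions_true. Qed.

Lemma mem_extensions n b h s :
  (s \in extensions n b h) = (size s == n) && extension b h s.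
Proof.
elim: n b h s => [|n IH] b h s.
  by rewrite inE; case: s.
have mem_asc : (s \in map (cons h.+1) (extensions n false h.+1)) =
    if s is v :: s' then [&& v == h.+1, size s' == n & extension false v s']
    else false.
  case: s => [|v s]; first by apply/mapP => -[].
  apply/mapP/andP => [[t + [-> ->]]|[/eqP-> H]]; first by rewrite IH.
  by exists s; rewrite // IH.
have mem_desc :
    (s \in [seq v :: s | v <- iota 0 h.+1, s <- extensions n true v]) =
    if s is v :: s' then [&& v <= h, size s' == n & extension true v s']
      else false.
  case: s {mem_asc} => [|v s]; first by apply/allpairsPdep => -[? [? []]].
  apply/allpairsPdep/andP => [[u [t [+ + [-> ->]]]]|[vh H]].
    by rewrite mem_iota IH ltnS => /andP[_ ->].
  by exists v, s; rewrite mem_iota IH ltnS vh.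
rewrite /= mem_cat mem_asc; case: b; rewrite ?mem_desc;
  case: s {mem_asc mem_desc} => [|v s] //=.
  by rewrite eqSS in_nil; case: (leqP v h); lia.
by rewrite eqSS; case: (leqP v h); lia.
Qed.

Lemma uniq_extensions n b h : uniq (extensions n b h).
Proof.
elim: n b h => [//|n IH] b h.
have uniq_true : uniq (extensions n.+1 true h).
  by rewrite extensions_true map_inj_uniq // => ? ? [].
case: b => //; rewrite extensions_false cat_uniq uniq_true andTb.
apply/andP; split; last first.
  apply: allpairs_uniq_dep => [|v _|[v s] [u t] _ _ /= [-> ->]] //.
  exact: iota_uniq.
rewrite extensions_true; apply/hasPn => w /allpairsPdep[v [s [vh _ ->]]].
apply/negP => /mapP[t _ [vE _]]; move: vh.
by rewrite vE mem_iota ltnn andbF.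
Qed.

End Words.

(** * Generating functions of the extensions *)

(** The exponent is the semiperimeter of [0 :: s] when [h = 0], less the 2 due to the initial
    letter, see [sper_catalan]. *)
Definition weight n b h : {poly rat} :=
  \sum_(s <- extensions n b h) 'X^(n + ascents h s).

Lemma weight0 b h : weight 0 b h = 1.
Proof. by rewrite /weight big_seq1. Qed.

Lemma weight_true n h : weight n.+1 true h = 'X^2 * weight n false h.+1.
Proof.
rewrite /weight extensions_true big_map mulr_sumr; apply: eq_bigr => s _.
by rewrite -exprD /= ltnSn; congr ('X^_); lia.
Qed.

(** A weak descent adds width but no rise, hence the single factor ['X], against ['X^2] for an
    ascent. *)
Lemma weight_false n h :
  weight n.+1 false h =
  weight n.+1 true h + 'X * \sum_(v < h.+1) weight n true v.
Proof.
rewrite /weight extensions_false big_cat big_allpairs_dep; congr (_ + _).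
rewrite mulr_sumr -(big_mkord xpredT (fun v => 'X * weight n true v)).
rewrite [RHS]big_nat /index_iota subn0 [RHS]big_seq_cond [LHS]big_seq.
rewrite [RHS](eq_bigl (fun i => i \in iota 0 h.+1)); last first.
  by move=> i; rewrite mem_iota; lia.
apply: eq_bigr => v; rewrite mem_iota => /= vh.
rewrite mulr_sumr; apply: eq_bigr => s _.
by rewrite -exprS; congr ('X^_); lia.
Qed.

Lemma S_series_coef n : S_series``_(n.+1) = 'X^2 * weight n false 0.
Proof.
pose words := [seq map val w | w : n.+1.-tuple 'I_n.+1 <- index_enum _ &
  catalan_word (map val w) && avoids_geq_geq (map val w)].
transitivity (\sum_(w <- words) 'X^(sper w) : {poly rat}).
  by rewrite big_map big_filter.
have words_perm : perm_eq words (map (cons 0%N) (extensions n false 0)).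
  apply: uniq_perm => [||w].
  - rewrite map_inj_uniq ?filter_uniq ?index_enum_uniq // => u v uv.
    by apply/val_inj/(inj_map val_inj).
  - by rewrite map_inj_uniq ?uniq_extensions // => ? ? [].
  apply/mapP/mapP => [[t + ->]|[s + ->]].
    rewrite mem_filter => /andP[/andP[cw aw] _]; case: t cw aw => /= t szt.
    case: t szt => [//|u t] szt /= /andP[/eqP u0 pt] at_.
    exists (map val t); last by rewrite u0.
    rewrite mem_extensions extensionE size_map -eqSS szt andTb andbT.
    by move: pt at_; rewrite /= u0 => -> ->.
  rewrite mem_extensions extensionE andbT => /and3P[/eqP sz ps as_].
  have cs : catalan_word (0%N :: s) by [].
  have bs : all (gtn n.+1) (0%N :: s).
    by apply/allP => x /(catalan_word_bound cs); rewrite /= sz.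
  (* All letters are below the length [n.+1], so [inord] does not alter them. *)
  have vK : map val (map (inord : nat -> 'I_n.+1) (0%N :: s)) = 0%N :: s.
    rewrite -map_comp map_id_in // => x /(allP bs) /= xn.
    by rewrite inordK.
  have szt : size (map (inord : nat -> 'I_n.+1) (0%N :: s)) == n.+1.
    by rewrite size_map /= sz.
  exists (Tuple szt); last by rewrite vK.
  by rewrite mem_filter mem_index_enum andbT [tval _]/= vK cs.
rewrite (perm_big _ words_perm) big_map mulr_sumr.
rewrite big_seq [RHS]big_seq; apply: eq_bigr => s.
rewrite mem_extensions extensionE => /and4P[/eqP sz ps _ _].
by rewrite sper_catalan // sz -exprD addnC.
Qed.

(* [ext_series 0] is [1 + S], and [ext_series h.+1] enumerates the extensions
   of a letter [h] that ends a weak descent. *)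
Definition ext_series (h : nat) : fps {poly rat} :=
  Fps (fun n => if n is n'.+1 then 'X^2 * weight n' false h else 1).

(** The ascent to [h.+1] forced after a weak descent is the ['X^2] built into [ext_series], so a
    single family serves both values of the flag. *)
Lemma coef_ext_seriesS h n : (ext_series h.+1)``_n = weight n true h.
Proof. by case: n => [|n]; rewrite ?weight0 ?weight_true. Qed.

(** The letter [h] itself gives p^2 x. If no weak descent follows, the continuations are those
    allowed after one; a weak descent to [j] adds p x, hence p^3 x^2. *)
Lemma ext_series_rec h :
  ext_series h = 1 + fpsX * fpsC ('X^2) * ext_series h.+1
          + fpsX * (fpsX * fpsC ('X^3)) * \sum_(j < h.+1) ext_series j.+1.
Proof.
apply/fpsP => -[|n]; rewrite !fps_coefD -!mulrA !(fps_coefXM0, fps_coefXMS).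
  by rewrite !addr0.
rewrite fps_coef1 add0r fps_coefCM [LHS]/=.
case: n => [|n].
  by rewrite fps_coefXM0 addr0 coef_ext_seriesS !weight0.
rewrite fps_coefXMS fps_coefCM fps_coef_sum coef_ext_seriesS weight_false.
rewrite mulrDr mulrA -exprSr; congr (_ + _ * _).
by apply: eq_bigr => j _; rewrite coef_ext_seriesS.
Qed.

Lemma ext_series0 : ext_series 0 = 1 + S_series.
Proof.
apply/fpsP => -[|n]; rewrite fps_coefD fps_coef1 ?addr0 //.
by rewrite add0r S_series_coef.
Qed.

(** * Solving the quadratic equation *)

Theorem theorem3p1 :
  let x : fps {poly rat} := fpsX in
  let p : fps {poly rat} := fpsC 'X in
  S_series%:F =
    (1 - p ^+ 2 * x - 2 * p ^+ 3 * x ^+ 2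
       - fps_sqrt (1 - 2 * p ^+ 2 * x + (p ^+ 4 - 4 * p ^+ 3) * x ^+ 2))%:F
    / (2 * p ^+ 3 * x ^+ 2)%:F.
Proof.
move=> x p.
have quad := catalytic_quadratic ext_series_rec.
rewrite ext_series0 -/x -!fpsC_exp -/p in quad.
set S := S_series in quad *.
have two0 : (2%:R : {poly rat}) != 0.
  by rewrite -polyC_natr polyC_eq0.
(* Completing the square gives the root 1 - a - 2 b K_0; its constant term 1 fixes the sign. *)
have sqrtE : fps_sqrt (1 - 2 * p ^+ 2 * x + (p ^+ 4 - 4 * p ^+ 3) * x ^+ 2)
    = 1 - p ^+ 2 * x - 2 * p ^+ 3 * x ^+ 2 * (1 + S).
  apply: fps_sqrt_uniq => //.
    rewrite !fps_coefB ![_ * x]mulrC [_ * x ^+ 2]mulrC expr2 -!mulrA.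
    by rewrite !fps_coefXM0 !subr0.
  move/eqP: quad; rewrite -subr_eq0 => /eqP quad.
  apply: subr0_eq.
  (* The squared candidate minus the discriminant is -4b times the defect of the quadratic. *)
  transitivity (- 4 * p ^+ 3 * x ^+ 2 * (1 + S -
    (1 + x * p ^+ 2 * (1 + S) + x * (x * p ^+ 3) * (1 + S) ^+ 2))).
    by ring.
  by rewrite quad mulr0.
have fpsC_neq0 (r : {poly rat}) : r != 0 -> fpsC r != 0.
  by apply: contraNneq => /(congr1 (fun a => a``_0)) /= ->.
have x0 : x != 0.
  by apply/eqP => /(congr1 (fun a => a``_1)) /eqP; rewrite /= oner_eq0.
have den0 : 2 * p ^+ 3 * x ^+ 2 != 0.
  rewrite !mulf_neq0 ?expf_neq0 ?fpsC_neq0 ?polyX_eq0 //.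
  by apply/eqP => /(congr1 (fun a => a``_0)) /eqP; exact/negP.
rewrite sqrtE; set d := 2 * _ * _.
have -> : 1 - p ^+ 2 * x - d - (1 - p ^+ 2 * x - d * (1 + S)) = S * d by ring.
by rewrite rmorphM mulfK // tofrac_eq0.
Qed.
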